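(* Let $\Omega$ be a nonempty set and $C$ a commutative unital $\mathbf{k}$-algebra. Let $j_C:C\hookrightarrow \mathfrak{S}(\Omega,C)$ be the natural injection. The pair $(\mathfrak{S}(\Omega,C),\Delta_\Omega)$ together with $j_C$ is the free $\Omega$-operated $\mathbf{k}$-algebra over $C$.
   Context: $\mathbf{k}$ is a field of characteristic $0$; all algebras are commutative unital $\mathbf{k}$-algebras, and tensor products are over $\mathbf{k}$. An $\Omega$-operated $\mathbf{k}$-algebra is a $\mathbf{k}$-algebra $V$ with $\mathbf{k}$-linear maps $P_\omega:V\to V$, $\omega\in\Omega$; write $P_\Omega=(P_\omega\mid\omega\in\Omega)$. A homomorphism $(V,P_\Omega)\to(U,Q_\Omega)$ is an algebra homomorphism $f$ with $fP_\omega=Q_\omega f$ for all $\omega$. The free $\Omega$-operated $\mathbf{k}$-algebra over $C$ is an $\Omega$-operated algebra $(F,\Pi_\Omega)$ with an algebra homomorphism $i_C:C\to F$ such that for any $\Omega$-operated algebra $(R,P_\Omega)$ and any algebra homomorphism $f:C\to R$ there is a unique $\Omega$-operated algebra homomorphism $\bar f:(F,\Pi_\Omega)\to(R,P_\Omega)$ with $\bar f\, i_C=f$. Construction of $\mathfrak{S}(\Omega,C)$ (bracketed words). For a module $V$ and $\omega\in\Omega$, $\lfloor V\rfloor_\omega$ is a copy of $V$, with a linear bijection $V\to\lfloor V\rfloor_\omega$, $v\mapsto\lfloor v\rfloor_\omega$; $\lfloor V\rfloor_\Omega:=\bigoplus_{\omega\in\Omega}\lfloor V\rfloor_\omega$.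 $S(V)$ is the symmetric algebra. Set $\mathfrak{S}_0:=C$ and, for $n\ge0$, $\mathfrak{S}_{n+1}:=C\otimes S(\lfloor\mathfrak{S}_n\rfloor_\Omega)$ (tensor product of algebras). The injection $\mathfrak{S}_0=C\hookrightarrow\mathfrak{S}_1$ is $c\mapsto c\otimes1$; an injection $\mathfrak{S}_{n-1}\hookrightarrow\mathfrak{S}_n$ induces $\lfloor\mathfrak{S}_{n-1}\rfloor_\Omega\hookrightarrow\lfloor\mathfrak{S}_n\rfloor_\Omega$ and hence an algebra injection $\mathfrak{S}_n\hookrightarrow\mathfrak{S}_{n+1}$. Define $\mathfrak{S}(\Omega,C):=\varinjlim\mathfrak{S}_n=\bigcup_{n\ge0}\mathfrak{S}_n$, and for $\omega\in\Omega$ define $\Delta_\omega:\mathfrak{S}(\Omega,C)\to\mathfrak{S}(\Omega,C)$ by $u\mapsto\lfloor u\rfloor_\omega$ (for $u\in\mathfrak{S}_n$, $\lfloor u\rfloor_\omega\in\lfloor \mathfrak{S}_n\rfloor_\omega\subseteq\mathfrak{S}_{n+1}$). $\Delta_\Omega=(\Delta_\omega\mid\omega\in\Omega)$. The natural injection $j_C$ is the inclusion of $C=\mathfrak{S}_0$. *)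

(* Defs.v *)
From HB Require Import structures.
From mathcomp Require Import all_boot all_algebra.
From mathcomp Require Import boolp classical_sets functions cardinality.

Set Implicit Arguments.
Unset Strict Implicit.
Unset Printing Implicit Defensive.

Import GRing.Theory.
Local Open Scope ring_scope.
Local Open Scope quotient_scope.

(* A commutative unital k-algebra is a k-module with a bilinear, associative,
   commutative and unital product.  The library's [comAlgType k] additionally
   requires [1 != 0]; here the zero algebra is allowed. *)
HB.mixin Record Lmodule_isCAlg (k : fieldType) A of GRing.Lmodule k A := {
  cone : A;
  cmul : A -> A -> A;
  cmulA : associative cmul;
  cmulC : commutative cmul;
  cmul1x : left_id cone cmul;
  cmulDl : left_distributive cmul +%R;
  cscalerAl : forall (a : k) (x y : A), a *: cmul x y = cmul (a *: x) y
}.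

#[short(type="calgType")]
HB.structure Definition CAlg (k : fieldType) :=
  {A of GRing.Lmodule k A & Lmodule_isCAlg k A}.

Arguments cone {k s}.

HB.instance Definition _ (k : fieldType) (A : comAlgType k) :=
  Lmodule_isCAlg.Build k A (@mulrA A) (@mulrC A) (@mul1r A) (@mulrDl A)
    (@scalerAl k A).

Record algHom (k : fieldType) (A B : calgType k) := AlgHom {
  alg_fun :> {linear A -> B};
  algHom1 : alg_fun cone = cone;
  algHomM : forall x y, alg_fun (cmul x y) = cmul (alg_fun x) (alg_fun y)
}.

Record opAlg (k : fieldType) (Omega : Type) := OpAlg {
  op_alg :> calgType k;
  op_fun : Omega -> {linear op_alg -> op_alg}
}.

Record opHom (k : fieldType) (Omega : Type) (V U : opAlg k Omega) := OpHom {
  op_hom :> algHom V U;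
  opHomP : forall w x, op_hom (op_fun V w x) = op_fun U w (op_hom x)
}.

Definition is_free_opAlg (k : fieldType) (Omega : Type) (C : calgType k)
    (F : opAlg k Omega) (i : algHom C F) : Prop :=
  forall (R : opAlg k Omega) (f : algHom C R),
    exists fbar : opHom F R,
      (forall c, fbar (i c) = f c) /\
      (forall g : opHom F R, (forall c, g (i c) = f c) -> g =1 fbar).

(* Formal sums of generators (sequences, added by concatenation) modulo the
   smallest additive congruence containing [r] and commutativity of [+].
   Opposites come from [gscale (-1)] below. *)
Inductive fsum_eq (M : Type) (r : seq M -> seq M -> Prop) :
    seq M -> seq M -> Prop :=
  | fsum_base s t : r s t -> fsum_eq r s t
  | fsum_refl s : fsum_eq r s s
  | fsum_sym s t : fsum_eq r s t -> fsum_eq r t s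
  | fsum_trans s t u : fsum_eq r s t -> fsum_eq r t u -> fsum_eq r s u
  | fsum_cat s s' t t' :
      fsum_eq r s s' -> fsum_eq r t t' -> fsum_eq r (s ++ t) (s' ++ t')
  | fsum_catC s t : fsum_eq r (s ++ t) (t ++ s).

Lemma fsum_perm (M : eqType) r (s t : seq M) : perm_eq s t -> fsum_eq r s t.
Proof.
elim: s t => [|x s IH] t; first by rewrite perm_sym => /perm_nilP->; exact: fsum_refl.
move=> st; have xt : x \in t by rewrite -(perm_mem st) mem_head.
case/splitPr: xt st => t1 t2; rewrite -cat1s perm_sym -[x :: t2]cat1s.
rewrite perm_catCA perm_cat2l perm_sym => /IH st.
have h : fsum_eq r ([:: x] ++ s) ([:: x] ++ (t1 ++ t2)).
  by apply: fsum_cat st; exact: fsum_refl.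
apply: fsum_trans h _; rewrite !catA; apply: fsum_cat (fsum_refl _ _).
exact: fsum_catC.
Qed.

Lemma fsum_map (M N : Type) r r' (h : M -> N) :
  (forall s t, r s t -> fsum_eq r' (map h s) (map h t)) ->
  forall s t, fsum_eq r s t -> fsum_eq r' (map h s) (map h t).
Proof.
move=> hr s t; elim=> {s t} [s t /hr//|s|s t _|s t u _ h1 _|s s' t t' _ h1 _ h2|s t].
- exact: fsum_refl.
- exact: fsum_sym.
- exact: fsum_trans.
- by rewrite !map_cat; apply: fsum_cat.
- by rewrite !map_cat; apply: fsum_catC.
Qed.

Lemma fsum_eq_map (M N : Type) r (g h : M -> N) :
  (forall m, fsum_eq r [:: g m] [:: h m]) ->
  forall s, fsum_eq r (map g s) (map h s).
Proof.
move=> gh; elim=> [|m s IH] /=; first exact: fsum_refl.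
by rewrite -cat1s -[h m :: _]cat1s; apply: fsum_cat.
Qed.

Lemma fsum_map2 (M N : Type) r (f g h : M -> N) :
  (forall m, fsum_eq r [:: f m] [:: g m; h m]) ->
  forall s, fsum_eq r (map f s) (map g s ++ map h s).
Proof.
move=> fgh; elim=> [|m s IH] /=; first exact: fsum_refl.
apply: (fsum_trans (t := [:: g m; h m] ++ (map g s ++ map h s))).
  by rewrite -cat1s; apply: fsum_cat.
rewrite -[g m :: map g s ++ _]cat1s -[[:: g m; h m]](cat1s (g m)) -!catA.
apply: fsum_cat (fsum_refl _ _) _.
rewrite -[h m :: map h s]cat1s !catA.
by apply: fsum_cat (fsum_refl _ _); apply: fsum_catC.
Qed.

(* Data making the quotient of formal sums over [gen] a commutative algebra:
   the product and the scaling are given on generators and extended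
   additively. *)
Record presentation (k : fieldType) := Presentation {
  gen : choiceType;
  grel : seq gen -> seq gen -> Prop;
  gone : gen;
  gmul : gen -> gen -> gen;
  gscale : k -> gen -> gen;
  gmul_rel : forall m s t, grel s t ->
    fsum_eq grel (map (gmul m) s) (map (gmul m) t);
  gscale_rel : forall a s t, grel s t ->
    fsum_eq grel (map (gscale a) s) (map (gscale a) t);
  gmulA : forall x y z,
    fsum_eq grel [:: gmul x (gmul y z)] [:: gmul (gmul x y) z];
  gmulC : forall x y, fsum_eq grel [:: gmul x y] [:: gmul y x];
  gmul1 : forall x, fsum_eq grel [:: gmul gone x] [:: x];
  gscaleA : forall a b x,
    fsum_eq grel [:: gscale a (gscale b x)] [:: gscale (a * b) x];
  gscale1 : forall x, fsum_eq grel [:: gscale 1 x] [:: x];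
  gscale0 : forall x, fsum_eq grel [:: gscale 0 x] [::];
  gscaleD : forall a b x,
    fsum_eq grel [:: gscale (a + b) x] [:: gscale a x; gscale b x];
  gscaleM : forall a x y,
    fsum_eq grel [:: gscale a (gmul x y)] [:: gmul (gscale a x) y]
}.

Section FormalSums.
Variables (k : fieldType) (P : presentation k).
Local Notation eqP_ := (fsum_eq (@grel k P)).

Definition fsum_eqb (s t : seq (gen P)) : bool := `[< eqP_ s t >].

Lemma fsum_eqb_equiv : equiv_class_of fsum_eqb.
Proof.
split=> [s|s t|t s u].
- by apply/asboolP; exact: fsum_refl.
- by apply/asboolP/asboolP; exact: fsum_sym.
- by move=> /asboolP st /asboolP tu; apply/asboolP; exact: fsum_trans st tu.
Qed.

Canonical fsum_equiv := EquivRelPack fsum_eqb_equiv.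

Definition fsum := {eq_quot fsum_equiv}.
HB.instance Definition _ := Choice.on fsum.
HB.instance Definition _ := Quotient.on fsum.
HB.instance Definition _ := EqQuotient.on fsum.

Definition fs (s : seq (gen P)) : fsum := \pi_fsum s.

Lemma fsP s t : fs s = fs t <-> eqP_ s t.
Proof.
by split=> [/eqmodP/asboolP|st] //; apply/eqmodP/asboolP.
Qed.

Lemma fs_ind (Q : fsum -> Prop) : (forall s, Q (fs s)) -> forall x, Q x.
Proof. by move=> h x; rewrite -[x]reprK; apply: h. Qed.

Lemma fs_reprK s : eqP_ (repr (fs s)) s.
Proof. by apply/fsP; rewrite /fs reprK. Qed.

Definition smul (s t : seq (gen P)) := [seq gmul x y | x <- s, y <- t].
Definition sscale a (s : seq (gen P)) := map (gscale a) s.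

Definition fs0 := fs [::].
Definition fs_add (x y : fsum) := fs (repr x ++ repr y).
Definition fs_scale a (x : fsum) := fs (sscale a (repr x)).
Definition fs_opp := fs_scale (- 1).
Definition fs_mul (x y : fsum) := fs (smul (repr x) (repr y)).

Lemma fs_addE s t : fs_add (fs s) (fs t) = fs (s ++ t).
Proof. by apply/fsP; apply: fsum_cat; exact: fs_reprK. Qed.

Lemma fs_scaleE a s : fs_scale a (fs s) = fs (sscale a s).
Proof. by apply/fsP; apply: fsum_map (fs_reprK s); exact: gscale_rel. Qed.

Lemma smulC s t : eqP_ (smul s t) (smul t s).
Proof.
elim: t => [|y t IH].
  by rewrite /smul; elim: s => [|x s IH] //=; exact: fsum_refl.
apply: (fsum_trans (t := map (fun x => gmul x y) s ++ smul s t)).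
  by apply: fsum_perm; rewrite /smul (perm_allpairs_consr _ _ (fun=> y)).
by apply: fsum_cat IH; apply: fsum_eq_map => x; exact: gmulC.
Qed.

Lemma smul_congr s s' t t' : eqP_ s s' -> eqP_ t t' -> 
  eqP_ (smul s t) (smul s' t').
Proof.
have R u v w : eqP_ v w -> eqP_ (smul u v) (smul u w).
  move=> vw; elim: u => [|x u IH] /=; first exact: fsum_refl.
  by apply: fsum_cat IH; apply: fsum_map vw; exact: gmul_rel.
move=> ss tt; apply: fsum_trans (R _ _ _ tt) _.
apply: fsum_trans (smulC _ _) _; apply: fsum_trans (R _ _ _ ss) _.
exact: smulC.
Qed.

Lemma fs_mulE s t : fs_mul (fs s) (fs t) = fs (smul s t).
Proof. by apply/fsP; apply: smul_congr; exact: fs_reprK. Qed.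

Fact fs_addA : associative fs_add.
Proof.
by elim/fs_ind=> s; elim/fs_ind=> t; elim/fs_ind=> u; rewrite !fs_addE catA.
Qed.
Fact fs_addC : commutative fs_add.
Proof.
elim/fs_ind=> s; elim/fs_ind=> t; rewrite !fs_addE; apply/fsP.
exact: fsum_catC.
Qed.
Fact fs_add0 : left_id fs0 fs_add.
Proof. by elim/fs_ind=> s; rewrite fs_addE. Qed.
Fact fs_scaleDl' x a b : 
  fs_scale (a + b) x = fs_add (fs_scale a x) (fs_scale b x).
Proof.
elim/fs_ind: x => s; rewrite !fs_scaleE fs_addE; apply/fsP.
by apply: fsum_map2 => m; exact: gscaleD.
Qed.
Fact fs_scale1 : left_id 1 fs_scale.
Proof.
elim/fs_ind=> s; rewrite fs_scaleE; apply/fsP.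
rewrite -[X in eqP_ _ X]map_id.
by apply: fsum_eq_map => m; exact: gscale1.
Qed.
Fact fs_scale0 x : fs_scale 0 x = fs0.
Proof.
elim/fs_ind: x => s; rewrite fs_scaleE; apply/fsP; rewrite /sscale.
elim: s => [|m s IH] /=; first exact: fsum_refl.
by rewrite -cat1s -[[::]]cats0; apply: fsum_cat IH; exact: gscale0.
Qed.
Fact fs_addN : left_inverse fs0 fs_opp fs_add.
Proof.
by move=> x; rewrite -{2}[x]fs_scale1 -fs_scaleDl' addNr fs_scale0.
Qed.

HB.instance Definition _ :=
  GRing.isZmodule.Build fsum fs_addA fs_addC fs_add0 fs_addN.

Fact fs_scaleA a b x : fs_scale a (fs_scale b x) = fs_scale (a * b) x.
Proof.
elim/fs_ind: x => s; rewrite !fs_scaleE; apply/fsP; rewrite /sscale -map_comp.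
by apply: fsum_eq_map => m /=; exact: gscaleA.
Qed.
Fact fs_scaleDr : right_distributive fs_scale +%R.
Proof.
move=> a; elim/fs_ind=> s; elim/fs_ind=> t.
by rewrite [_ + _]fs_addE !fs_scaleE [_ + _]fs_addE /sscale map_cat.
Qed.
Fact fs_scaleDl x : {morph fs_scale^~ x : a b / a + b}.
Proof. by move=> a b; exact: fs_scaleDl'. Qed.

HB.instance Definition _ :=
  GRing.Zmodule_isLmodule.Build k fsum fs_scaleA fs_scale1 fs_scaleDr
    fs_scaleDl.

Lemma smul_cat s t u : smul (s ++ t) u = smul s u ++ smul t u.
Proof. by rewrite /smul allpairs_cat. Qed.

Fact fs_mulC : commutative fs_mul.
Proof.
by elim/fs_ind=> s; elim/fs_ind=> t; rewrite !fs_mulE; apply/fsP; exact: smulC.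
Qed.
Fact fs_mulDl : left_distributive fs_mul +%R.
Proof.
elim/fs_ind=> s; elim/fs_ind=> t; elim/fs_ind=> u.
by rewrite [_ + _]fs_addE !fs_mulE [_ + _]fs_addE smul_cat.
Qed.
Fact fs_scaleAl a x y : fs_scale a (fs_mul x y) = fs_mul (fs_scale a x) y.
Proof.
elim/fs_ind: x => s; elim/fs_ind: y => t.
rewrite !(fs_mulE, fs_scaleE); apply/fsP.
elim: s => [|m s IH] /=; first exact: fsum_refl.
rewrite /sscale map_cat; apply: fsum_cat IH; rewrite -map_comp.
by apply: fsum_eq_map => n /=; exact: gscaleM.
Qed.
Fact fs_mul1 : left_id (fs [:: gone P]) fs_mul.
Proof.
elim/fs_ind=> s; rewrite fs_mulE; apply/fsP; rewrite /smul /= cats0.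
by rewrite -[X in eqP_ _ X]map_id; apply: fsum_eq_map => m; exact: gmul1.
Qed.
Fact fs_mulA : associative fs_mul.
Proof.
elim/fs_ind=> s; elim/fs_ind=> t; elim/fs_ind=> u; rewrite !fs_mulE; apply/fsP.
elim: s => [|x s IH] /=; first exact: fsum_refl.
rewrite smul_cat; apply: fsum_cat IH => {s}.
elim: t => [|y t IH] /=; first exact: fsum_refl.
rewrite map_cat; apply: fsum_cat IH; rewrite -map_comp.
by apply: fsum_eq_map => z /=; exact: gmulA.
Qed.

HB.instance Definition _ :=
  Lmodule_isCAlg.Build k fsum fs_mulA fs_mulC fs_mul1 fs_mulDl fs_scaleAl.

Lemma fsD s t : fs (s ++ t) = fs s + fs t.
Proof. by rewrite [RHS]fs_addE. Qed.
Lemma fsZ a s : fs (map (gscale a) s) = a *: fs s.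
Proof. by rewrite [RHS]fs_scaleE. Qed.
Lemma fsM s t : fs (smul s t) = cmul (fs s) (fs t).
Proof. by rewrite [RHS]fs_mulE. Qed.

End FormalSums.

Section FormalSumMap.
Variables (k : fieldType) (P Q : presentation k) (h : gen P -> gen Q).
Hypothesis hrel : forall s t, grel s t ->
  fsum_eq (@grel k Q) (map h s) (map h t).
Hypothesis h1 : fsum_eq (@grel k Q) [:: h (gone P)] [:: gone Q].
Hypothesis hM : forall x y,
  fsum_eq (@grel k Q) [:: h (gmul x y)] [:: gmul (h x) (h y)].
Hypothesis hZ : forall a x,
  fsum_eq (@grel k Q) [:: h (gscale a x)] [:: gscale a (h x)].

Definition fs_map_fun (x : fsum P) : fsum Q := fs (map h (repr x)).

Lemma fs_map_funE s : fs_map_fun (fs s) = fs (map h s).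
Proof. by apply/fsP; apply: fsum_map (fs_reprK s). Qed.

Fact fs_map_linear : linear fs_map_fun.
Proof.
move=> a; elim/fs_ind=> s; elim/fs_ind=> t.
rewrite -fsZ -fsD !fs_map_funE map_cat fsD; congr (_ + _).
rewrite -fsZ; apply/fsP; rewrite -!map_comp.
by apply: fsum_eq_map => m /=.
Qed.

HB.instance Definition _ :=
  GRing.isLinear.Build k (fsum P) (fsum Q) _ fs_map_fun fs_map_linear.

Fact fs_map1 : fs_map_fun cone = cone.
Proof. by rewrite [LHS]fs_map_funE; apply/fsP. Qed.

Fact fs_mapM x y : fs_map_fun (cmul x y) = cmul (fs_map_fun x) (fs_map_fun y).
Proof.
elim/fs_ind: x => s; elim/fs_ind: y => t; rewrite -fsM !fs_map_funE -fsM.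
apply/fsP; elim: s => [|x s IH] /=; first exact: fsum_refl.
rewrite map_cat; apply: fsum_cat IH; rewrite -!map_comp.
by apply: fsum_eq_map => y /=.
Qed.

Definition fs_map : algHom (fsum P) (fsum Q) := AlgHom fs_map1 fs_mapM.

Lemma fs_mapE s : fs_map (fs s) = fs (map h s).
Proof. exact: fs_map_funE. Qed.

End FormalSumMap.

Section Tensor.
Variables (k : fieldType) (A B : calgType k).

(* [[:: (a1, b1); ..; (an, bn)]] stands for the sum of the [ai (x) bi]. *)
Inductive tensor_rel : seq (A * B) -> seq (A * B) -> Prop :=
  | tensor_Dl a a' b : tensor_rel [:: (a + a', b)] [:: (a, b); (a', b)]
  | tensor_Dr a b b' : tensor_rel [:: (a, b + b')] [:: (a, b); (a, b')]
  | tensor_Z c a b : tensor_rel [:: (c *: a, b)] [:: (a, c *: b)]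
  | tensor_0 b : tensor_rel [:: (0, b)] [::].

Definition tensor_pres : presentation k.
Proof.
apply: (@Presentation k _ tensor_rel (cone, cone)
  (fun x y => (cmul x.1 y.1, cmul x.2 y.2)) (fun a x => (a *: x.1, x.2))).
- move=> [x y] s t [a a' b|a b b'|c a b|b] /=; apply: fsum_base.
  + by rewrite !(cmulC x) cmulDl; exact: tensor_Dl.
  + by rewrite !(cmulC y) cmulDl; exact: tensor_Dr.
  + by rewrite !(cmulC x) !(cmulC y) -!cscalerAl; exact: tensor_Z.
  + have -> : cmul x 0 = 0.
      by rewrite cmulC -{1}(scale0r (0 : A)) -cscalerAl scale0r.
    exact: tensor_0.
- move=> e s t [a a' b|a b b'|c a b|b] /=; apply: fsum_base.
  + by rewrite scalerDr; exact: tensor_Dl.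
  + exact: tensor_Dr.
  + by rewrite scalerA mulrC -scalerA; exact: tensor_Z.
  + by rewrite scaler0; exact: tensor_0.
- by move=> x y z /=; rewrite !cmulA; exact: fsum_refl.
- by move=> x y /=; rewrite (cmulC x.1) (cmulC x.2); exact: fsum_refl.
- by move=> [a b] /=; rewrite !cmul1x; exact: fsum_refl.
- by move=> a b x /=; rewrite scalerA; exact: fsum_refl.
- by move=> [a b] /=; rewrite scale1r; exact: fsum_refl.
- by move=> [a b] /=; rewrite scale0r; apply: fsum_base; exact: tensor_0.
- by move=> a b x; rewrite scalerDl; apply: fsum_base; exact: tensor_Dl.
- by move=> a x y /=; rewrite cscalerAl; exact: fsum_refl.
Defined.

Definition tensor : calgType k := fsum tensor_pres.

Definition pure (a : A) (b : B) : tensor := fs (P := tensor_pres) [:: (a, b)].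

End Tensor.

Section Symmetric.
Variables (k : fieldType) (V : lmodType k).

(* [(a, [:: v1; ..; vn])] stands for the monomial [a v1 ... vn]. *)
Inductive sym_rel : seq (k * seq V) -> seq (k * seq V) -> Prop :=
  | sym_perm a w w' : perm_eq w w' -> sym_rel [:: (a, w)] [:: (a, w')]
  | sym_Dk a b w : sym_rel [:: (a + b, w)] [:: (a, w); (b, w)]
  | sym_0 w : sym_rel [:: (0, w)] [::]
  | sym_D a u v w :
      sym_rel [:: (a, (u + v) :: w)] [:: (a, u :: w); (a, v :: w)]
  | sym_Z a c v w : sym_rel [:: (a, (c *: v) :: w)] [:: (a * c, v :: w)].

Definition sym_pres : presentation k.
Proof.
apply: (@Presentation k _ sym_rel (1, [::])
  (fun x y => (x.1 * y.1, x.2 ++ y.2)) (fun a x => (a * x.1, x.2))).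
- have L (b : k) (x v : seq V) w : 
    fsum_eq sym_rel [:: (b, x ++ v ++ w)] [:: (b, v ++ x ++ w)].
    by apply: fsum_base; apply: sym_perm; rewrite perm_catCA.
  have L1 b x v w :
    fsum_eq sym_rel [:: (b, x ++ v :: w)] [:: (b, v :: x ++ w)].
    exact: (L b x [:: v] w).
  move=> [e x] s t [a w w' ww|a b w|w|a u v w|a c v w] /=.
  + by apply: fsum_base; apply: sym_perm; rewrite perm_cat2l.
  + by rewrite mulrDr; apply: fsum_base; exact: sym_Dk.
  + by rewrite mulr0; apply: fsum_base; exact: sym_0.
  + apply: fsum_trans (L1 _ _ _ _) _.
    apply: fsum_trans (fsum_base (sym_D _ _ _ _)) _.
    rewrite -cat1s -[X in fsum_eq _ _ X]cat1s.
    by apply: fsum_cat; apply: fsum_sym; exact: L1.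
  + apply: fsum_trans (L1 _ _ _ _) _.
    apply: fsum_trans (fsum_base (sym_Z _ _ _ _)) _.
    by rewrite mulrA; apply: fsum_sym; exact: L1.
- move=> e s t [a w w' ww|a b w|w|a u v w|a c v w] /=; apply: fsum_base.
  + exact: sym_perm.
  + by rewrite mulrDr; exact: sym_Dk.
  + by rewrite mulr0; exact: sym_0.
  + exact: sym_D.
  + by rewrite mulrA; exact: sym_Z.
- by move=> x y z /=; rewrite mulrA catA; exact: fsum_refl.
- move=> x y /=; rewrite mulrC; apply: fsum_base; apply: sym_perm.
  by rewrite perm_catC.
- by move=> [a w] /=; rewrite mul1r; exact: fsum_refl.
- by move=> a b x /=; rewrite mulrA; exact: fsum_refl.
- by move=> [a w] /=; rewrite mul1r; exact: fsum_refl.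
- by move=> [a w] /=; rewrite mul0r; apply: fsum_base; exact: sym_0.
- by move=> a b x; rewrite mulrDl; apply: fsum_base; exact: sym_Dk.
- by move=> a x y /=; rewrite mulrA; exact: fsum_refl.
Defined.

Definition symAlg : calgType k := fsum sym_pres.

Definition sym_in (v : V) : symAlg := fs (P := sym_pres) [:: (1, [:: v])].

End Symmetric.

Section DirectSum.
Variables (k : fieldType) (Omega : Type) (V : lmodType k).

Definition fin_supp : {pred Omega -> V} :=
  fun f => `[< finite_set [set w | f w != 0]%classic >].

Fact fin_supp_closed : submod_closed fin_supp.
Proof.
split=> [|a f g /asboolP ff /asboolP fg]; apply/asboolP.
  by apply: sub_finite_set (finite_set0 Omega) => w /=; rewrite eqxx.
apply: (sub_finite_set (B := [set w | f w != 0] `|` [set w | g w != 0])%classic).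
  move=> w /=; have -> : (a *: f + g) w = a *: f w + g w by [].
  have [->|] := eqVneq (f w) 0; last by left.
  by rewrite scaler0 add0r; right.
by rewrite finite_setU.
Qed.

HB.instance Definition _ :=
  GRing.isSubmodClosed.Build k (Omega -> V) fin_supp fin_supp_closed.

(* The direct sum of copies of [V] indexed by [Omega]: finitely supported
   functions. *)
Record brk := Brk { brk_val : Omega -> V; _ : brk_val \in fin_supp }.

HB.instance Definition _ := [isSub for brk_val].
HB.instance Definition _ := [Choice of brk by <:].
HB.instance Definition _ := [SubChoice_isSubLmodule of brk by <:].

Definition single (w : Omega) (v : V) : Omega -> V :=
  fun w' => if `[< w' = w >] then v else 0.

Fact single_fin_supp w v : single w v \in fin_supp.
Proof.
apply/asboolP; apply: sub_finite_set (finite_set1 w) => w' /=.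
by rewrite /single; case: asboolP => // _; rewrite eqxx.
Qed.

Definition bracket (w : Omega) (v : V) : brk := Brk (single_fin_supp w v).

Fact bracket_linear w : linear (bracket w).
Proof.
move=> a u v; apply: val_inj; rewrite linearP /=.
apply/funext => w'; rewrite !fctE /single.
by case: asboolP => //; rewrite scaler0 addr0.
Qed.

End DirectSum.
Arguments bracket {k Omega V}.

Section SymLinear.
Variables (k : fieldType) (V : lmodType k).

Fact sym_in_linear : linear (@sym_in k V).
Proof.
move=> a u v; rewrite /sym_in -fsZ -fsD; apply/fsP => /=.
apply: fsum_trans (fsum_base (sym_D _ _ _ _)) _.
rewrite -cat1s -[X in fsum_eq _ _ X]cat1s; apply: fsum_cat (fsum_refl _ _).
by rewrite mulrC; apply: fsum_base; exact: sym_Z.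
Qed.

End SymLinear.

Section TensorLinear.
Variables (k : fieldType) (A B : calgType k).

Fact pure_linearl b : linear (fun a : A => pure a b : tensor A B).
Proof.
move=> c x y; rewrite /pure -fsZ -fsD; apply/fsP => /=.
by apply: fsum_base; exact: tensor_Dl.
Qed.

Fact pure_linearr a : linear (fun b : B => pure a b : tensor A B).
Proof.
move=> c x y; rewrite /pure -fsZ -fsD; apply/fsP => /=.
apply: fsum_trans (fsum_base (tensor_Dr _ _ _)) _.
rewrite -cat1s -[X in fsum_eq _ _ X]cat1s; apply: fsum_cat (fsum_refl _ _).
by apply: fsum_sym; apply: fsum_base; exact: tensor_Z.
Qed.

Definition tensor_inl (a : A) : tensor A B := pure a cone.

HB.instance Definition _ :=
  GRing.isLinear.Build k A (tensor A B) _ tensor_inl (pure_linearl cone).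

Fact tensor_inlM x y : tensor_inl (cmul x y) = cmul (tensor_inl x) (tensor_inl y).
Proof. by rewrite /tensor_inl /pure -[RHS]fsM /smul /= cmul1x. Qed.

Definition tensor_inl_hom : algHom A (tensor A B) :=
  AlgHom (erefl : tensor_inl cone = cone) tensor_inlM.

End TensorLinear.

Section Functoriality.
Variable (k : fieldType).

Definition alg_id (A : calgType k) : algHom A A :=
  @AlgHom k A A (idfun : {linear A -> A}) erefl (fun _ _ => erefl).

Section BracketMap.
Variables (Omega : Type) (V W : lmodType k) (f : {linear V -> W}).

Fact brk_map_supp (x : brk Omega V) : f \o \val x \in @fin_supp k Omega W.
Proof.
apply/asboolP; have /asboolP := valP x.
apply: sub_finite_set => w /=; apply: contra => /eqP ->.
by rewrite linear0.
Qed.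

Definition brk_map (x : brk Omega V) : brk Omega W := Brk (brk_map_supp x).

Fact brk_map_linear : linear brk_map.
Proof.
move=> a x y; apply: val_inj; rewrite !linearP /=.
by apply/funext => w /=; rewrite !fctE linearP.
Qed.

HB.instance Definition _ :=
  GRing.isLinear.Build k (brk Omega V) (brk Omega W) _ brk_map brk_map_linear.

Lemma brk_map_bracket w v : brk_map (bracket w v) = bracket w (f v).
Proof.
apply: val_inj; apply/funext => w' /=; rewrite /single.
by case: asboolP => //; rewrite linear0.
Qed.

End BracketMap.

Section SymMap.
Variables (V W : lmodType k) (f : {linear V -> W}).

Definition sym_map : algHom (symAlg V) (symAlg W).
Proof.
apply: (@fs_map k (sym_pres V) (sym_pres W) (fun x => (x.1, map f x.2))).
- move=> s t [a w w' ww|a b w|w|a u v w|a c v w] /=; apply: fsum_base.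
  + by apply: sym_perm; exact: perm_map.
  + exact: sym_Dk.
  + exact: sym_0.
  + by rewrite linearD; exact: sym_D.
  + by rewrite linearZ; exact: sym_Z.
- exact: fsum_refl.
- by move=> x y /=; rewrite map_cat; exact: fsum_refl.
- by move=> a x; exact: fsum_refl.
Defined.

End SymMap.

Section TensorMap.
Variables (A A' B B' : calgType k) (f : algHom A A') (g : algHom B B').

Definition tensor_map : algHom (tensor A B) (tensor A' B').
Proof.
apply: (@fs_map k (tensor_pres A B) (tensor_pres A' B')
  (fun x => (f x.1, g x.2))).
- move=> s t [a a' b|a b b'|c a b|b] /=; apply: fsum_base.
  + by rewrite linearD; exact: tensor_Dl.
  + by rewrite linearD; exact: tensor_Dr.
  + by rewrite !linearZ; exact: tensor_Z.
  + by rewrite linear0; exact: tensor_0.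
- by rewrite /= !algHom1; exact: fsum_refl.
- by move=> x y /=; rewrite !algHomM; exact: fsum_refl.
- by move=> a x /=; rewrite linearZ; exact: fsum_refl.
Defined.

End TensorMap.

Lemma sym_map_in (V W : lmodType k) (f : {linear V -> W}) v :
  sym_map f (sym_in v) = sym_in (f v).
Proof. exact: fs_mapE. Qed.

Lemma tensor_map_pure (A A' B B' : calgType k) (f : algHom A A')
  (g : algHom B B') a b : tensor_map f g (pure a b) = pure (f a) (g b).
Proof. exact: fs_mapE. Qed.

End Functoriality.

Section DirectLimit.
Variable (k : fieldType).

(* The transition map [A n -> A m] of a sequential direct system; it is only
   meaningful when [n <= m], and is [0] otherwise. *)
Fixpoint trans (n : nat) : forall (A : nat -> calgType k)
    (i : forall j, algHom (A j) (A j.+1)) (m : nat), A n -> A m :=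
  match n with
  | 0 => fun A i => fix go m : A 0 -> A m :=
      match m with
      | 0 => id
      | m'.+1 => fun x => i m' (go m' x)
      end
  | n'.+1 => fun A i m =>
      match m with
      | 0 => fun _ => 0
      | m'.+1 => @trans n' (fun j => A j.+1) (fun j => i j.+1) m'
      end
  end.

Lemma transnn n A i x : @trans n A i n x = x.
Proof. by elim: n A i x => //= n IH A i x; exact: IH. Qed.

Lemma transS n A i m x : (n <= m)%N ->
  @trans n A i m.+1 x = i m (@trans n A i m x).
Proof.
elim: n A i m x => [|n IH] A i [|m] x //= nm.
by rewrite -(IH _ (fun j => i j.+1) m x nm).
Qed.

Variables (A : nat -> calgType k) (i : forall n, algHom (A n) (A n.+1)).
Local Notation tr := (@trans _ A i).

Lemma trans_trans n m p x : (n <= m)%N -> (m <= p)%N ->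
  tr p (tr m x) = tr p (x : A n).
Proof.
move=> nm; elim: p => [|p IH]; first by rewrite leqn0 => /eqP <-; rewrite transnn.
rewrite leq_eqVlt => /predU1P[<-|mp]; first by rewrite transnn.
by rewrite !transS ?IH // (leq_trans nm).
Qed.

Lemma trans_linear n m a x y : (n <= m)%N ->
  tr m (a *: x + y : A n) = a *: tr m x + tr m y.
Proof.
elim: m => [|m IH]; first by case: n x y => // x y _; rewrite !transnn.
rewrite leq_eqVlt => /predU1P[e|nm]; first by subst n; rewrite !transnn.
by rewrite !transS // IH // linearP.
Qed.

Lemma transM n m x y : (n <= m)%N ->
  tr m (cmul x y : A n) = cmul (tr m x) (tr m y).
Proof.
elim: m => [|m IH]; first by case: n x y => // x y _; rewrite !transnn.
rewrite leq_eqVlt => /predU1P[e|nm]; first by subst n; rewrite !transnn.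
by rewrite !transS // IH // algHomM.
Qed.

Lemma trans1 n m : (n <= m)%N -> tr m (cone : A n) = cone.
Proof.
elim: m => [|m IH]; first by case: n => // _; rewrite !transnn.
rewrite leq_eqVlt => /predU1P[e|nm]; first by subst n; rewrite !transnn.
by rewrite !transS // IH // algHom1.
Qed.

Definition dl_rel (u v : {n : nat & A n}) : Prop :=
  exists p, [/\ (tag u <= p)%N, (tag v <= p)%N &
    tr p (tagged u) = tr p (tagged v)].

Definition dl_eqb (u v : {n : nat & A n}) : bool := `[< dl_rel u v >].

Lemma dl_eqb_equiv : equiv_class_of dl_eqb.
Proof.
split=> [u|u v|v u w].
- by apply/asboolP; exists (tag u).
- by apply/asboolP/asboolP=> -[p [h1 h2 h3]]; exists p; split.
- move=> /asboolP[p [up vp e]] /asboolP[q [vq wq e']]; apply/asboolP.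
  exists (maxn p q); rewrite !leq_max up wq orbT; split=> //.
  rewrite -(trans_trans _ up) ?leq_maxl // e trans_trans ?leq_maxl //.
  by rewrite -(trans_trans _ vq) ?leq_maxr // e' trans_trans ?leq_maxr.
Qed.

Canonical dl_equiv := EquivRelPack dl_eqb_equiv.

Definition dirlim := {eq_quot dl_equiv}.
HB.instance Definition _ := Choice.on dirlim.
HB.instance Definition _ := Quotient.on dirlim.
HB.instance Definition _ := EqQuotient.on dirlim.

Definition dl_in (n : nat) (x : A n) : dirlim :=
  \pi_dirlim (existT (fun n => A n : Type) n x).

Lemma dl_inP n m (x : A n) (y : A m) : dl_in x = dl_in y <->
  exists p, [/\ (n <= p)%N, (m <= p)%N & tr p x = tr p y].
Proof.
by split=> [/eqmodP/asboolP|st] //; apply/eqmodP/asboolP.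
Qed.

Lemma dl_in_trans n m (x : A n) : (n <= m)%N -> dl_in (tr m x) = dl_in x.
Proof. by move=> nm; apply/dl_inP; exists m; split; rewrite ?transnn. Qed.

Lemma dl_ind (Q : dirlim -> Prop) : (forall n (x : A n), Q (dl_in x)) ->
  forall u, Q u.
Proof. by move=> h u; rewrite -[u]reprK; case: (repr u) => n x; exact: h. Qed.

Lemma dl_ind2 (Q : dirlim -> dirlim -> Prop) :
  (forall n (x y : A n), Q (dl_in x) (dl_in y)) -> forall u v, Q u v.
Proof.
move=> h; elim/dl_ind=> n x; elim/dl_ind=> m y.
rewrite -(dl_in_trans x (leq_maxl n m)) -(dl_in_trans y (leq_maxr n m)).
exact: h.
Qed.

Lemma dl_ind3 (Q : dirlim -> dirlim -> dirlim -> Prop) :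
  (forall n (x y z : A n), Q (dl_in x) (dl_in y) (dl_in z)) ->
  forall u v w, Q u v w.
Proof.
move=> h; apply: dl_ind2 => n x y; elim/dl_ind=> m z.
rewrite -(dl_in_trans x (leq_maxl n m)) -(dl_in_trans y (leq_maxl n m)).
rewrite -(dl_in_trans z (leq_maxr n m)).
exact: h.
Qed.

Definition dl_op2 (op : forall n, A n -> A n -> A n) (u v : dirlim) : dirlim :=
  let n := tag (repr u) in let m := tag (repr v) in
  dl_in (op (maxn n m) (tr (maxn n m) (tagged (repr u)))
                       (tr (maxn n m) (tagged (repr v)))).
Definition dl_op1 (op : forall n, A n -> A n) (u : dirlim) : dirlim :=
  dl_in (op (tag (repr u)) (tagged (repr u))).

Lemma dl_repr n (x : A n) : exists p, [/\ (tag (repr (dl_in x)) <= p)%N,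
  (n <= p)%N & tr p (tagged (repr (dl_in x))) = tr p x].
Proof.
suff /dl_inP : dl_in (tagged (repr (dl_in x))) = dl_in x by [].
by rewrite -[RHS]reprK; case: (repr _).
Qed.

Lemma dl_op1E (op : forall n, A n -> A n) :
  (forall n x, i n (op n x) = op n.+1 (i n x)) ->
  forall n (x : A n), dl_op1 op (dl_in x) = dl_in (op n x).
Proof.
move=> opi n x.
have tr_op m q (y : A m) : (m <= q)%N -> tr q (op m y) = op q (tr q y).
  elim: q => [|q IH]; first by case: m y => // y _; rewrite !transnn.
  rewrite leq_eqVlt => /predU1P[e|nm]; first by subst m; rewrite !transnn.
  by rewrite !transS // IH // opi.
have [p [h1 h2 e]] := dl_repr x.
by apply/dl_inP; exists p; split=> //; rewrite !tr_op // e.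
Qed.

Lemma dl_op2E (op : forall n, A n -> A n -> A n) :
  (forall n x y, i n (op n x y) = op n.+1 (i n x) (i n y)) ->
  forall n (x y : A n), dl_op2 op (dl_in x) (dl_in y) = dl_in (op n x y).
Proof.
move=> opi n x y.
have tr_op m q (a b : A m) : (m <= q)%N ->
    tr q (op m a b) = op q (tr q a) (tr q b).
  elim: q => [|q IH]; first by case: m a b => // a b _; rewrite !transnn.
  rewrite leq_eqVlt => /predU1P[e|nm]; first by subst m; rewrite !transnn.
  by rewrite !transS // IH // opi.
have [p [h1 h2 e]] := dl_repr x; have [q [h3 h4 e']] := dl_repr y.
rewrite /dl_op2; set u := repr (dl_in x) in h1 e *.
set v := repr (dl_in y) in h3 e' *; set r := maxn _ _.
have [pr qr] := (leq_maxl p q, leq_maxr p q).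
have rr : (r <= maxn p q)%N by rewrite geq_max !leq_max h1 h3 orbT.
apply/dl_inP; exists (maxn p q); split=> //; first exact: leq_trans h2 pr.
rewrite !tr_op //; last exact: leq_trans h2 pr.
rewrite !trans_trans ?leq_maxl ?leq_maxr //.
rewrite -(trans_trans _ h1 pr) e (trans_trans _ h2 pr).
by rewrite -(trans_trans _ h3 qr) e' (trans_trans _ h4 qr).
Qed.

Definition dl_add := dl_op2 (fun n => +%R).
Definition dl_mul := dl_op2 (fun n => cmul).
Definition dl_scale a := dl_op1 (fun n => *:%R a).
Definition dl_opp := dl_op1 (fun n => -%R).

Lemma dl_addE n (x y : A n) : dl_add (dl_in x) (dl_in y) = dl_in (x + y).
Proof. by apply: (dl_op2E (op := fun n => +%R)) => *; exact: linearD. Qed.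
Lemma dl_mulE n (x y : A n) : dl_mul (dl_in x) (dl_in y) = dl_in (cmul x y).
Proof. by apply: (dl_op2E (op := fun n => cmul)) => *; exact: algHomM. Qed.
Lemma dl_scaleE a n (x : A n) : dl_scale a (dl_in x) = dl_in (a *: x).
Proof. by apply: (dl_op1E (op := fun n => *:%R a)) => *; exact: linearZ. Qed.
Lemma dl_oppE n (x : A n) : dl_opp (dl_in x) = dl_in (- x).
Proof. by apply: (dl_op1E (op := fun n => -%R)) => *; exact: linearN. Qed.

Lemma dl_in0 n : dl_in (0 : A n) = dl_in (0 : A 0).
Proof.
rewrite -(dl_in_trans (0 : A 0) (leq0n n)).
have := trans_linear (-1) (0 : A 0) 0 (leq0n n).
by rewrite scaler0 addr0 scaleN1r addNr => ->.
Qed.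
Lemma dl_in1 n : dl_in (cone : A n) = dl_in (cone : A 0).
Proof. by rewrite -(dl_in_trans (cone : A 0) (leq0n n)) trans1. Qed.

Fact dl_addA : associative dl_add.
Proof. by apply: dl_ind3 => n x y z; rewrite !dl_addE addrA. Qed.
Fact dl_addC : commutative dl_add.
Proof. by apply: dl_ind2 => n x y; rewrite !dl_addE addrC. Qed.
Fact dl_add0 : left_id (dl_in (0 : A 0)) dl_add.
Proof. by elim/dl_ind=> n x; rewrite -(dl_in0 n) dl_addE add0r. Qed.
Fact dl_addN : left_inverse (dl_in (0 : A 0)) dl_opp dl_add.
Proof. by elim/dl_ind=> n x; rewrite dl_oppE dl_addE addNr dl_in0. Qed.

HB.instance Definition _ :=
  GRing.isZmodule.Build dirlim dl_addA dl_addC dl_add0 dl_addN.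

Lemma dl_inD n (x y : A n) : dl_in (x + y) = dl_in x + dl_in y.
Proof. by rewrite -dl_addE. Qed.

Fact dl_scaleA a b u : dl_scale a (dl_scale b u) = dl_scale (a * b) u.
Proof. by elim/dl_ind: u => n x; rewrite !dl_scaleE scalerA. Qed.
Fact dl_scale1 : left_id 1 dl_scale.
Proof. by elim/dl_ind=> n x; rewrite dl_scaleE scale1r. Qed.
Fact dl_scaleDr : right_distributive dl_scale +%R.
Proof.
move=> a; apply: dl_ind2 => n x y.
by rewrite -dl_inD !dl_scaleE -dl_inD scalerDr.
Qed.
Fact dl_scaleDl u : {morph dl_scale^~ u : a b / a + b}.
Proof.
by move=> a b; elim/dl_ind: u => n x; rewrite !dl_scaleE -dl_inD scalerDl.
Qed.

HB.instance Definition _ :=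
  GRing.Zmodule_isLmodule.Build k dirlim dl_scaleA dl_scale1 dl_scaleDr
    dl_scaleDl.

Fact dl_mulA : associative dl_mul.
Proof. by apply: dl_ind3 => n x y z; rewrite !dl_mulE cmulA. Qed.
Fact dl_mulC : commutative dl_mul.
Proof. by apply: dl_ind2 => n x y; rewrite !dl_mulE cmulC. Qed.
Fact dl_mul1 : left_id (dl_in (cone : A 0)) dl_mul.
Proof. by elim/dl_ind=> n x; rewrite -(dl_in1 n) dl_mulE cmul1x. Qed.
Fact dl_mulDl : left_distributive dl_mul +%R.
Proof.
apply: dl_ind3 => n x y z; by rewrite -dl_inD !dl_mulE -dl_inD cmulDl.
Qed.
Fact dl_scaleAl a u v : dl_scale a (dl_mul u v) = dl_mul (dl_scale a u) v.
Proof.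
by move: u v; apply: dl_ind2 => n x y; rewrite !(dl_mulE, dl_scaleE) cscalerAl.
Qed.

HB.instance Definition _ :=
  Lmodule_isCAlg.Build k dirlim dl_mulA dl_mulC dl_mul1 dl_mulDl dl_scaleAl.

Fact dl_in_linear n : linear (@dl_in n).
Proof. by move=> a x y; rewrite dl_inD -dl_scaleE. Qed.

HB.instance Definition _ n :=
  GRing.isLinear.Build k (A n) dirlim _ (@dl_in n) (@dl_in_linear n).

Fact dl_inM n (x y : A n) : dl_in (cmul x y) = cmul (dl_in x) (dl_in y).
Proof. by rewrite [RHS]dl_mulE. Qed.

Definition dl_hom n : algHom (A n) dirlim := AlgHom (dl_in1 n) (@dl_inM n).

Lemma dl_in_inj n : (forall m, injective (i m)) -> injective (@dl_in n).
Proof.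
move=> inj x y /dl_inP[p [np _]]; elim: p np => [|p IH].
  by case: n x y => // x y _; rewrite !transnn.
rewrite leq_eqVlt => /predU1P[e|np]; first by subst n; rewrite !transnn.
by rewrite !transS // => /inj; exact: IH.
Qed.

End DirectLimit.

Section BracketedWords.
Variables (k : fieldType) (Omega : Type) (C : calgType k).

Definition frakS_step (X : calgType k) : calgType k :=
  tensor C (symAlg (brk Omega X)).

Definition step_map (X Y : calgType k) (f : algHom X Y) :
    algHom (frakS_step X) (frakS_step Y) :=
  tensor_map (alg_id C) (sym_map (brk_map (Omega := Omega) f)).

Fixpoint frakSn (n : nat) : calgType k :=
  if n is n'.+1 then frakS_step (frakSn n') else C.

Fixpoint frakS_incl (n : nat) : algHom (frakSn n) (frakSn n.+1) :=
  if n is n'.+1 then step_map (frakS_incl n')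
  else tensor_inl_hom C (symAlg (brk Omega C)).

Definition frakS : calgType k := dirlim frakS_incl.

Definition frakS_bracket (w : Omega) (n : nat) (u : frakSn n) : frakSn n.+1 :=
  pure cone (sym_in (bracket w u)).

Definition Delta_fun (w : Omega) (u : frakS) : frakS :=
  dl_in frakS_incl (frakS_bracket w (tagged (repr u))).

Lemma frakS_incl_bracket w n (u : frakSn n) :
  frakS_incl n.+1 (frakS_bracket w u) = frakS_bracket w (frakS_incl n u).
Proof.
rewrite [LHS]tensor_map_pure; congr (pure _ _).
by rewrite [LHS]sym_map_in; congr sym_in; exact: brk_map_bracket.
Qed.

Lemma Delta_funE w n (u : frakSn n) :
  Delta_fun w (dl_in frakS_incl u) = dl_in frakS_incl (frakS_bracket w u).
Proof.
have tr_b m q (x : frakSn m) : (m <= q)%N ->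
    trans frakS_incl q.+1 (frakS_bracket w x)
    = frakS_bracket w (trans frakS_incl q x).
  elim: q => [|q IH]; first by case: m x => // x _; rewrite !transnn.
  rewrite leq_eqVlt => /predU1P[e|mq]; first by subst m; rewrite !transnn.
  rewrite (transS _ _ (m := q.+1)) ?ltnS // IH // transS //.
  exact: frakS_incl_bracket.
have [p [h1 h2 e]] := dl_repr frakS_incl u.
by apply/dl_inP; exists p.+1; split=> //; rewrite !tr_b // e.
Qed.

Fact frakS_bracket_linear w n : linear (@frakS_bracket w n).
Proof.
by move=> a x y; rewrite /frakS_bracket bracket_linear sym_in_linear pure_linearr.
Qed.

Fact Delta_linear w : linear (Delta_fun w).
Proof.
move=> a; apply: dl_ind2 => n x y.
by rewrite -dl_in_linear !Delta_funE frakS_bracket_linear dl_in_linear.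
Qed.

HB.instance Definition _ w :=
  GRing.isLinear.Build k frakS frakS _ (Delta_fun w) (Delta_linear w).

Definition Delta (w : Omega) : {linear frakS -> frakS} := Delta_fun w.

Definition frakS_op : opAlg k Omega := OpAlg Delta.

Definition jC : algHom C frakS_op := dl_hom frakS_incl 0.

End BracketedWords.

Lemma fsum_sum (M : Type) (W : zmodType) r (h : M -> W) :
  (forall s t, r s t -> \sum_(x <- s) h x = \sum_(x <- t) h x) ->
  forall s t, fsum_eq r s t -> \sum_(x <- s) h x = \sum_(x <- t) h x.
Proof.
move=> hr s t; elim=> {s t} [s t /hr//|//|//|s t u _ -> _ ->//||].
  by move=> s s' t t' _ e _ e'; rewrite !big_cat /= e e'.
by move=> s t; rewrite !big_cat /= addrC.
Qed.

Section Injectivity.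
Variables (k : fieldType) (Omega : Type).

Section Augmentation.
Variables (C : calgType k) (V : lmodType k).

Let h (x : k * seq V) : k := if x.2 is [::] then x.1 else 0.
Let aug (x : symAlg V) : k := \sum_(y <- repr x) h y.

Let augE s : aug (fs (P := sym_pres V) s) = \sum_(y <- s) h y.
Proof.
apply: fsum_sum (fs_reprK (P := sym_pres V) s) => {}s t.
case=> [a w w' ww|a b w|w|a u v w|a c v w]; rewrite ?big_cons ?big_nil /h /=.
- by case: w w' ww => [|x w] [|y w'] // /perm_size.
- by case: w; rewrite !addr0.
- by case: w; rewrite addr0.
- by rewrite !addr0.
- by [].
Qed.

Let aug_lin a x y : aug (a *: x + y) = a * aug x + aug y.
Proof.
elim/fs_ind: x => s; elim/fs_ind: y => t.
rewrite -fsZ -fsD !augE big_cat big_map mulr_sumr; congr (_ + _).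
by apply: eq_bigr => -[b [|v w]] _ //; rewrite /h /= mulr0.
Qed.

Let aug0 : aug 0 = 0.
Proof. by rewrite augE big_nil. Qed.

Let g (x : C * symAlg V) : C := aug x.2 *: x.1.
Let ret (x : tensor C (symAlg V)) : C := \sum_(y <- repr x) g y.

Let retE s : ret (fs (P := tensor_pres C (symAlg V)) s) = \sum_(y <- s) g y.
Proof.
apply: fsum_sum (fs_reprK (P := tensor_pres C (symAlg V)) s) => {}s t.
case=> [a a' b|a b b'|c a b|b]; rewrite ?big_cons ?big_nil /g /= ?addr0.
- exact: scalerDr.
- by rewrite -{1}[b]scale1r aug_lin mul1r scalerDl.
- by rewrite -[c *: b]addr0 aug_lin aug0 addr0 scalerA mulrC.
- exact: scaler0.
Qed.

Let ret_linear : linear ret.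
Proof.
move=> a; elim/fs_ind=> s; elim/fs_ind=> t.
rewrite -fsZ -fsD !retE big_cat big_map scaler_sumr; congr (_ + _).
by apply: eq_bigr => -[c b] _; rewrite /g /= !scalerA mulrC.
Qed.

HB.instance Definition _ :=
  GRing.isLinear.Build k (tensor C (symAlg V)) C _ ret ret_linear.

Lemma tensor_inl_retract : exists r : {linear tensor C (symAlg V) -> C},
  cancel (tensor_inl_hom C (symAlg V)) r.
Proof.
exists ret => c; rewrite [LHS]retE big_seq1 /g augE big_seq1 /h /=.
exact: scale1r.
Qed.

End Augmentation.

Variable C : calgType k.

Lemma frakS_incl_retract n :
  exists r : {linear frakSn Omega C n.+1 -> frakSn Omega C n},
    cancel (frakS_incl Omega C n) r.
Proof.
elim: n => [|n [r rK]]; first exact: tensor_inl_retract.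
exists (tensor_map (alg_id C) (sym_map (brk_map (Omega := Omega) r))) => x.
have brK : cancel (brk_map (Omega := Omega) (frakS_incl Omega C n)) (brk_map r).
  by move=> y; apply: val_inj; apply/funext => w /=; rewrite rK.
have syK : cancel (sym_map (brk_map (Omega := Omega) (frakS_incl Omega C n)))
    (sym_map (brk_map r)).
  elim/fs_ind=> s; rewrite [sym_map _ (fs s)]fs_mapE fs_mapE -map_comp.
  by congr fs; rewrite -[RHS]map_id; apply: eq_map => -[a w] /=; rewrite mapK.
elim/fs_ind: x => s; rewrite [frakS_incl _ _ _ _]fs_mapE fs_mapE -map_comp.
by congr fs; rewrite -[RHS]map_id; apply: eq_map => -[a b] /=; rewrite syK.
Qed.

(* The direct system is injective, so that the direct limit is the union. *)
Lemma frakS_incl_inj n : injective (frakS_incl Omega C n).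
Proof. by have [r rK] := frakS_incl_retract n; exact: can_inj rK. Qed.

Lemma jC_inj : injective (jC Omega C).
Proof. by move=> x y; apply: dl_in_inj => m; exact: frakS_incl_inj. Qed.

End Injectivity.

(* Main.v *)
Require Import Defs.
From mathcomp Require Import all_boot all_algebra.
From HB Require Import structures.
From mathcomp Require Import boolp classical_sets functions cardinality fsbigop.

Set Implicit Arguments.
Unset Strict Implicit.
Unset Printing Implicit Defensive.

Import GRing.Theory.
Local Open Scope ring_scope.

(** Each stage of the construction is assembled from a tensor product, a
    symmetric algebra, a direct sum and finally a direct limit, and each of
    these constructions has a universal property: a map out of it can be
    prescribed freely on its generators, and is determined by its values there.
    Freeness is what these properties add up to.

    Let [f : C -> R] be a morphism to an operated algebra [(R, P)]. Given an
    algebra map [g] from a stage [X] to [R], a morphism from the next stage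
    [C (x) S([X]_Omega)] to [R] is the same thing as a morphism on [C] together
    with a family of linear maps on [X], one for each [w]; taking [f] and
    [P_w \o g] gives [step_lift f g]. Starting from [f] on the bottom stage and
    iterating yields maps [level_lift f n]. They agree along the inclusions
    ([level_lift_incl]): both sides of the compatibility are algebra maps out
    of a stage, so it is enough to compare them on [c (x) 1] and on
    [1 (x) [u]_w], where the claim is the compatibility one stage below. The
    induced map on the limit commutes with the operators because [step_lift]
    sends [[u]_w] to [P_w (g u)].

    Uniqueness is the same induction: a morphism of operated algebras which
    extends [f] and is known on a stage is known on the brackets of that
    stage, hence, with its values on [C], on the whole next stage
    ([frakS_hom_ext]). *)

(** * Sums and products in commutative algebras *)

(** Registering the product as a commutative monoid law gives access to the
    iterated products used as values of monomials of the symmetric algebra. *)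
HB.instance Definition _ (k : fieldType) (A : calgType k) :=
  Monoid.isComLaw.Build A cone cmul (@cmulA k A) (@cmulC k A) (@cmul1x k A).

Section AlgebraSums.
Variables (k : fieldType) (A : calgType k).
Implicit Types x y z : A.

Lemma cmulDr x y z : cmul x (y + z) = cmul x y + cmul x z.
Proof. by rewrite !(cmulC x) cmulDl. Qed.

Lemma cscalerAr (a : k) x y : a *: cmul x y = cmul x (a *: y).
Proof. by rewrite !(cmulC x) cscalerAl. Qed.

Lemma cmul0x x : cmul 0 x = 0.
Proof. by rewrite -[X in cmul X _](scale0r 0) -cscalerAl scale0r. Qed.

Lemma cmulACA : interchange (@cmul k A) (@cmul k A).
Proof. by move=> x y z t; rewrite !cmulA -!(cmulA x) (cmulC y). Qed.

Lemma cmul_suml I (s : seq I) (F : I -> A) y :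
  cmul (\sum_(i <- s) F i) y = \sum_(i <- s) cmul (F i) y.
Proof.
by elim/big_rec2: _ => [|i u v _ <-]; rewrite ?cmul0x // cmulDl.
Qed.

Lemma cmul_sumr I (s : seq I) (F : I -> A) x :
  cmul x (\sum_(i <- s) F i) = \sum_(i <- s) cmul x (F i).
Proof. by rewrite cmulC cmul_suml; under eq_bigr do rewrite cmulC. Qed.

End AlgebraSums.

Section Composition.
Variables (k : fieldType) (A B D : calgType k).
Variables (g : algHom B D) (f : algHom A B).

Fact alg_comp1 : (g \o f) cone = cone.
Proof. by rewrite /= !algHom1. Qed.

Fact alg_compM x y : (g \o f) (cmul x y) = cmul ((g \o f) x) ((g \o f) y).
Proof. by rewrite /= !algHomM. Qed.

Definition alg_comp : algHom A D := @AlgHom k A D (g \o f) alg_comp1 alg_compM.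

End Composition.

(** * Universal property of an algebra of formal sums *)

Section PresentedAlgebra.
Variables (k : fieldType) (P : presentation k) (A : calgType k).

Lemma fs_sum (s : seq (gen P)) : fs s = \sum_(x <- s) fs [:: x].
Proof. by elim: s => [|x s IH]; rewrite ?big_nil // big_cons -IH -fsD. Qed.

Lemma fsum_hom_ext (f g : algHom (fsum P) A) :
  (forall x, f (fs [:: x]) = g (fs [:: x])) -> f =1 g.
Proof.
move=> fg; elim/fs_ind=> s; rewrite fs_sum !linear_sum.
by apply: eq_bigr => x _; exact: fg.
Qed.

(** A multiplicative and homogeneous assignment on the generators extends
    additively to formal sums; invariance under the defining relations makes
    the extension independent of the formal sum chosen. *)
Variable h : gen P -> A.
Hypothesis hrel : forall s t, Defs.grel s t ->
  \sum_(x <- s) h x = \sum_(x <- t) h x.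
Hypothesis h1 : h (gone P) = cone.
Hypothesis hM : forall x y, h (gmul x y) = cmul (h x) (h y).
Hypothesis hZ : forall a x, h (gscale a x) = a *: h x.

Definition fs_lift_fun (u : fsum P) : A := \sum_(x <- repr u) h x.

Lemma fs_lift_funE s : fs_lift_fun (fs s) = \sum_(x <- s) h x.
Proof. exact: fsum_sum hrel _ _ (fs_reprK s). Qed.

Fact fs_lift_linear : linear fs_lift_fun.
Proof.
move=> a; elim/fs_ind=> s; elim/fs_ind=> t.
rewrite -fsZ -fsD !fs_lift_funE big_cat big_map scaler_sumr.
by under eq_bigr do rewrite hZ.
Qed.

HB.instance Definition _ :=
  GRing.isLinear.Build k (fsum P) A _ fs_lift_fun fs_lift_linear.

Fact fs_lift1 : fs_lift_fun cone = cone.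
Proof. by rewrite [LHS]fs_lift_funE big_seq1. Qed.

Fact fs_liftM u v :
  fs_lift_fun (cmul u v) = cmul (fs_lift_fun u) (fs_lift_fun v).
Proof.
elim/fs_ind: u => s; elim/fs_ind: v => t; rewrite -fsM !fs_lift_funE.
rewrite cmul_suml big_allpairs_dep; apply: eq_bigr => x _.
by rewrite cmul_sumr; apply: eq_bigr => y _.
Qed.

Definition fs_lift : algHom (fsum P) A := AlgHom fs_lift1 fs_liftM.

Lemma fs_liftE x : fs_lift (fs [:: x]) = h x.
Proof. by rewrite [LHS]fs_lift_funE big_seq1. Qed.

End PresentedAlgebra.

(** * Universal property of the tensor product *)

Section TensorUniversal.
Variables (k : fieldType) (A B R : calgType k).

Lemma pureM (a a' : A) (b b' : B) :
  cmul (pure a b) (pure a' b') = pure (cmul a a') (cmul b b').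
Proof. by rewrite -fsM. Qed.

Definition tensor_inr (b : B) : tensor A B := pure cone b.

HB.instance Definition _ :=
  GRing.isLinear.Build k B (tensor A B) _ tensor_inr (pure_linearr cone).

Fact tensor_inrM x y :
  tensor_inr (cmul x y) = cmul (tensor_inr x) (tensor_inr y).
Proof. by rewrite [RHS]pureM cmul1x. Qed.

Definition tensor_inr_hom : algHom B (tensor A B) :=
  AlgHom (erefl : tensor_inr cone = cone) tensor_inrM.

(** The two factors generate the tensor product as an algebra, since
    [a (x) b] is the product of [a (x) 1] and [1 (x) b]. *)
Lemma tensor_hom_ext (f g : algHom (tensor A B) R) :
  (forall a, f (pure a cone) = g (pure a cone)) ->
  (forall b, f (pure cone b) = g (pure cone b)) -> f =1 g.
Proof.
move=> fgA fgB; apply: fsum_hom_ext => -[a b].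
rewrite -/(pure a b) -[a](cmul1x) cmulC -[b]cmul1x -pureM.
by rewrite !algHomM fgA fgB.
Qed.

Variables (f : algHom A R) (g : algHom B R).

(** The tensor product is the coproduct of commutative algebras. *)
Definition tensor_lift : algHom (tensor A B) R.
Proof.
apply: (@fs_lift k (tensor_pres A B) R (fun x => cmul (f x.1) (g x.2))).
- move=> s t [a a' b|a b b'|c a b|b]; rewrite ?big_cons ?big_nil ?addr0 /=.
  + by rewrite linearD cmulDl.
  + by rewrite linearD cmulDr.
  + by rewrite !linearZ -cscalerAl cscalerAr.
  + by rewrite linear0 cmul0x.
- by rewrite /= !algHom1 cmul1x.
- by move=> x y; rewrite /= !algHomM cmulACA.
- by move=> a x; rewrite /= linearZ -cscalerAl.
Defined.

Lemma tensor_lift_pure a b : tensor_lift (pure a b) = cmul (f a) (g b).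
Proof. exact: fs_liftE. Qed.

End TensorUniversal.

(** * Universal property of the symmetric algebra *)

Section SymmetricUniversal.
Variables (k : fieldType) (V : lmodType k) (R : calgType k).

(** A monomial [a v1 ... vn] is a scalar multiple of a product of vectors, so
    the vectors generate the symmetric algebra. *)
Lemma sym_hom_ext (f g : algHom (symAlg V) R) :
  (forall v, f (sym_in v) = g (sym_in v)) -> f =1 g.
Proof.
move=> fg; apply: fsum_hom_ext => -[a w].
have -> : fs (P := sym_pres V) [:: (a, w)]
    = a *: fs (P := sym_pres V) [:: (1, w)].
  by rewrite -fsZ /= mulr1.
rewrite !linearZ; congr (_ *: _); elim: w => [|v w IH].
  by rewrite [LHS](algHom1 f) [RHS](algHom1 g).
have -> : fs (P := sym_pres V) [:: (1, v :: w)]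
    = cmul (sym_in v) (fs (P := sym_pres V) [:: (1, w)]).
  by rewrite -fsM /smul /= mul1r.
by rewrite !algHomM fg IH.
Qed.

Variable l : {linear V -> R}.

Let monomial (w : seq V) : R := \big[cmul/cone]_(v <- w) l v.

Definition sym_lift : algHom (symAlg V) R.
Proof.
apply: (@fs_lift k (sym_pres V) R (fun x => x.1 *: monomial x.2)).
- move=> s t [a w w' ww|a b w|w|a u v w|a c v w];
    rewrite ?big_cons ?big_nil ?addr0 /=.
  + by rewrite /monomial (perm_big _ ww).
  + exact: scalerDl.
  + exact: scale0r.
  + by rewrite /monomial !big_cons linearD cmulDl scalerDr.
  + by rewrite /monomial !big_cons linearZ -cscalerAl scalerA.
- by rewrite /= /monomial big_nil scale1r.
- by move=> x y; rewrite /= /monomial big_cat -cscalerAl -cscalerAr scalerA.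
- by move=> a x; rewrite /= scalerA.
Defined.

Lemma sym_lift_in v : sym_lift (sym_in v) = l v.
Proof. by rewrite [LHS]fs_liftE /= scale1r /monomial big_seq1. Qed.

End SymmetricUniversal.

(** * Universal property of the direct sum of copies of a module *)

Section BracketUniversal.
Variables (k : fieldType) (Omega : Type) (V W : lmodType k).
Implicit Types (x y : brk Omega V) (s : seq {classic Omega}).

(** Sums over the support are computed over any larger finite list of indices,
    which allows one list to serve several elements at once. The index set has
    no given decidable equality, hence [{classic Omega}]. *)
Definition brk_covers x s := uniq s /\ forall w, w \notin s -> \val x w = 0.

Lemma brk_coversP x : exists s, brk_covers x s.
Proof.
have /asboolP/(@finite_seqP {classic Omega})[s sE] := valP x.
exists (undup s); split=> [|w]; first exact: undup_uniq.
rewrite mem_undup => ws; apply/eqP; apply: contraNT ws => xw.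
by have : [set` s]%classic w by rewrite -sE.
Qed.

Lemma brk_coversP2 x y : exists s, brk_covers x s /\ brk_covers y s.
Proof.
have [[s [_ sx]] [t [_ ty]]] := (brk_coversP x, brk_coversP y).
exists (undup (s ++ t)); split; split; try exact: undup_uniq.
  by move=> w; rewrite mem_undup mem_cat negb_or => /andP[/sx].
by move=> w; rewrite mem_undup mem_cat negb_or => /andP[_ /ty].
Qed.

Lemma brk_sum_bracket x s : brk_covers x s ->
  x = \sum_(w <- s) bracket w (\val x w).
Proof.
move=> [us sx]; apply: val_inj; apply/funext => w.
rewrite raddf_sum /= fct_sumE /=.
have [ws|ws] := boolP ((w : {classic Omega}) \in s).
  rewrite (bigD1_seq (w : {classic Omega})) //= /single asboolT // big1 ?addr0 //.
  by move=> v vw; rewrite asboolF // => wv; rewrite wv eqxx in vw.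
rewrite sx // big1_seq // => v /= vs; rewrite /single asboolF // => wv.
by rewrite wv vs in ws.
Qed.

(** Every element of the direct sum is a finite sum of brackets. *)
Lemma brk_linear_ext (f g : {linear brk Omega V -> W}) :
  (forall w v, f (bracket w v) = g (bracket w v)) -> f =1 g.
Proof.
move=> fg x; have [s /brk_sum_bracket->] := brk_coversP x.
by rewrite !linear_sum; apply: eq_bigr => w _; exact: fg.
Qed.

Variable p : Omega -> {linear V -> W}.

(** The sum over all indices makes sense because [p w] kills the zero
    components, and it avoids choosing a list that covers the support. *)
Definition brk_lift x : W :=
  \sum_(w \in [set: {classic Omega}]) p w (\val x w).

Lemma brk_liftE x s : brk_covers x s ->
  brk_lift x = \sum_(w <- s) p w (\val x w).
Proof.
move=> [us sx]; rewrite fsbig_seq //; symmetry; apply: fsbig_widen => //.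
by move=> w [_ /negP/sx xw] /=; rewrite xw linear0.
Qed.

Fact brk_lift_linear : linear brk_lift.
Proof.
move=> a x y; have [s [sx sy]] := brk_coversP2 x y.
have sxy : brk_covers (a *: x + y) s.
  split=> [|w ws]; first by case: sx.
  rewrite linearP /= !fctE.
  by rewrite (proj2 sx) // (proj2 sy) // scaler0 addr0.
rewrite !(@brk_liftE _ s) // scaler_sumr -big_split; apply: eq_bigr => w _ /=.
by rewrite !fctE linearP.
Qed.

HB.instance Definition _ :=
  GRing.isLinear.Build k (brk Omega V) W _ brk_lift brk_lift_linear.

Lemma brk_lift_bracket w v : brk_lift (bracket w v) = p w v.
Proof.
rewrite (@brk_liftE _ [:: w : {classic Omega}]).
  by rewrite big_seq1 /= /single asboolT.
split=> // w'; rewrite inE => /eqP ww' /=.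
by rewrite /single asboolF.
Qed.

End BracketUniversal.

(** * Universal property of the direct limit *)

Section DirectLimitUniversal.
Variables (k : fieldType) (A : nat -> calgType k).
Variables (i : forall n, algHom (A n) (A n.+1)) (R : calgType k).
Variable g : forall n, algHom (A n) R.
Hypothesis gi : forall n x, g n.+1 (i n x) = g n x.

(** An element of the limit is evaluated at the stage of its canonical
    representative; compatibility of the cocone makes any stage give the same
    value. *)
Definition dl_lift_fun (u : dirlim i) : R := g (tag (repr u)) (tagged (repr u)).

Lemma cocone_trans n m (x : A n) : (n <= m)%N -> g m (trans i m x) = g n x.
Proof.
elim: m => [|m IH]; first by case: n x => // x _; rewrite transnn.
rewrite leq_eqVlt => /predU1P[e|nm]; first by subst n; rewrite transnn.
by rewrite transS // gi IH.
Qed.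

Lemma dl_in_incl n (x : A n) : dl_in i (i n x) = dl_in i x.
Proof. by rewrite -(dl_in_trans i x (leqnSn n)) transS // transnn. Qed.

Lemma dl_lift_funE n (x : A n) : dl_lift_fun (dl_in i x) = g n x.
Proof.
have [p [h1 h2 e]] := dl_repr i x.
by rewrite /dl_lift_fun -(cocone_trans _ h1) e cocone_trans.
Qed.

Fact dl_lift_linear : linear dl_lift_fun.
Proof.
move=> a; apply: dl_ind2 => n x y.
by rewrite -dl_in_linear !dl_lift_funE linearP.
Qed.

HB.instance Definition _ :=
  GRing.isLinear.Build k (dirlim i) R _ dl_lift_fun dl_lift_linear.

Fact dl_lift1 : dl_lift_fun cone = cone.
Proof. by rewrite [LHS]dl_lift_funE algHom1. Qed.

Fact dl_liftM u v : dl_lift_fun (cmul u v) = cmul (dl_lift_fun u) (dl_lift_fun v).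
Proof.
move: u v; apply: dl_ind2 => n x y.
by rewrite -dl_inM !dl_lift_funE algHomM.
Qed.

Definition dl_lift : algHom (dirlim i) R := AlgHom dl_lift1 dl_liftM.

Lemma dl_liftE n (x : A n) : dl_lift (dl_in i x) = g n x.
Proof. exact: dl_lift_funE. Qed.

End DirectLimitUniversal.

(** * Extending a morphism to bracketed words *)

Section Extension.
Variables (k : fieldType) (Omega : Type) (C : calgType k).

(** Generators of the next stage as an algebra: the coefficients in [C] and the
    brackets of elements of the previous stage. *)
Lemma frakS_step_hom_ext (X R : calgType k)
    (f g : algHom (frakS_step Omega C X) R) :
  (forall c, f (pure c cone) = g (pure c cone)) ->
  (forall w u, f (pure cone (sym_in (bracket w u)))
             = g (pure cone (sym_in (bracket w u)))) ->
  f =1 g.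
Proof.
move=> fgC fgX; apply: tensor_hom_ext fgC _.
pose inr := tensor_inr_hom C (symAlg (brk Omega X)).
apply: (sym_hom_ext (f := alg_comp f inr) (g := alg_comp g inr)) => v /=.
(* [sym_hom_ext] reduces the claim to vectors of the direct sum; the two maps
   to compare are now linear on it, so brackets suffice. *)
pose gen_of (h : algHom (frakS_step Omega C X) R) (v : brk Omega X) : R :=
  h (tensor_inr C (sym_in v)).
have gen_lin h : linear (gen_of h).
  by move=> a u u'; rewrite /gen_of sym_in_linear !linearP.
pose gen_linear h := HB.pack_for {linear brk Omega X -> R} (gen_of h)
  (GRing.isLinear.Build k _ R _ (gen_of h) (gen_lin h)).
exact: (@brk_linear_ext k Omega X R (gen_linear f) (gen_linear g) fgX v).
Qed.

Lemma frakS_incl_inl n c :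
  frakS_incl Omega C n.+1 (pure c cone) = pure c cone.
Proof. by rewrite [LHS]tensor_map_pure algHom1. Qed.

Variables (R : opAlg k Omega) (f : algHom C R).

(** The only candidate: [f] on coefficients, and [[u]_w] sent to [P_w (g u)], as
    a morphism of operated algebras must do. *)
Definition step_lift (X : calgType k) (g : algHom X R) :
    algHom (frakS_step Omega C X) R :=
  tensor_lift f (sym_lift (brk_lift (fun w => op_fun R w \o g))).

Lemma step_lift_inl X (g : algHom X R) c : step_lift g (pure c cone) = f c.
Proof. by rewrite [LHS]tensor_lift_pure algHom1 cmulC cmul1x. Qed.

Lemma step_lift_bracket X (g : algHom X R) w u :
  step_lift g (pure cone (sym_in (bracket w u))) = op_fun R w (g u).
Proof.
rewrite [LHS]tensor_lift_pure algHom1 cmul1x sym_lift_in.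
exact: brk_lift_bracket.
Qed.

Fixpoint level_lift n : algHom (frakSn Omega C n) R :=
  if n is n'.+1 then step_lift (level_lift n') else f.

(** On a bracket [[u]_w] the compatibility at one stage reads [P_w] applied to
    the compatibility of the previous stage at [u]. *)
Lemma level_lift_incl n x :
  level_lift n.+1 (frakS_incl Omega C n x) = level_lift n x.
Proof.
elim: n x => [|n IH]; first exact: step_lift_inl.
apply: (frakS_step_hom_ext
  (f := alg_comp (level_lift n.+2) (frakS_incl Omega C n.+1))
  (g := level_lift n.+1)) => [c|w u].
  rewrite (step_lift_inl (level_lift n)).
  exact: etrans (congr1 _ (frakS_incl_inl n c)) (step_lift_inl _ _).
rewrite (step_lift_bracket (level_lift n)) -IH.
exact: etrans (congr1 _ (frakS_incl_bracket w u)) (step_lift_bracket _ _ _).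
Qed.

Definition frakS_lift_alg : algHom (frakS Omega C) R := dl_lift level_lift_incl.

Lemma frakS_lift_op w u :
  frakS_lift_alg (op_fun (frakS_op Omega C) w u) = op_fun R w (frakS_lift_alg u).
Proof.
elim/dl_ind: u => n x; rewrite [op_fun _ _ _]Delta_funE !dl_liftE.
exact: step_lift_bracket.
Qed.

Definition frakS_lift : opHom (frakS_op Omega C) R := OpHom frakS_lift_op.

Lemma frakS_lift_jC c : frakS_lift (jC Omega C c) = f c.
Proof. exact: (dl_liftE level_lift_incl (n := 0)). Qed.

(** The coefficients in [C] are the same elements of the union at every
    stage. *)
Lemma dl_in_inl n c :
  dl_in (frakS_incl Omega C) (n := n.+1) (pure c cone) = jC Omega C c.
Proof.
elim: n => [|n <-].
  exact: (dl_in_incl (frakS_incl Omega C) (n := 0)).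
by rewrite -[RHS]dl_in_incl; congr (dl_in _ _); rewrite frakS_incl_inl.
Qed.

(** The algebra [C] generates [frakS] as an operated algebra: every stage is
    generated by [C] and by brackets of elements of the previous one. *)
Lemma frakS_hom_ext (g h : opHom (frakS_op Omega C) R) :
  (forall c, g (jC Omega C c) = h (jC Omega C c)) -> g =1 h.
Proof.
move=> gh; elim/dl_ind=> n; elim: n => [|n IH]; first exact: gh.
pose inn := dl_hom (frakS_incl Omega C) n.+1.
apply: (frakS_step_hom_ext (f := alg_comp g inn) (g := alg_comp h inn)) => [c|w u].
  by rewrite [LHS]/= [RHS]/= dl_in_inl gh.
rewrite [LHS]/= [RHS]/= -[dl_in _ _]Delta_funE.
rewrite [LHS](opHomP g) [RHS](opHomP h); congr (op_fun _ _ _).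
exact: IH.
Qed.

End Extension.

Theorem theorem3p5 (k : fieldType) (Omega : Type) (C : calgType k) :
  [pchar k]%R =i pred0 ->
  inhabited Omega ->
  is_free_opAlg (F := frakS_op Omega C) (jC Omega C).
Proof.
move=> _ _ R f; exists (frakS_lift f); split=> [c|g gf].
  exact: frakS_lift_jC.
by apply: frakS_hom_ext => c; rewrite gf frakS_lift_jC.
Qed.
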